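(* The following representations hold: $$\zeta(3)=\frac{8}{7}\int_0^1\arctan t\,\arctan\frac1t\,\frac{dt}{t},$$ $$\zeta(3)=\int_0^1\log(1+t)\,\log\left(1+\frac1t\right)\frac{dt}{t},$$ and the first of these is equivalent to the (hence also valid) evaluation $$\int_0^1\frac{(\arctan t)^2}{t}\,dt=\frac{\pi}{2}G-\frac78\zeta(3).$$
   Context: $\zeta(3)=\sum_{n=1}^\infty\frac1{n^3}$, and $G=\sum_{n=0}^\infty\frac{(-1)^n}{(2n+1)^2}=\int_0^1\frac{\arctan t}{t}\,dt$ is Catalan's constant. *)

(* Defs.v *)
(* Standard-library reals with Coquelicot. *)
From Stdlib Require Import Reals.
From Coquelicot Require Import Coquelicot.
Open Scope R_scope.

Definition zeta3 : R := Series (fun n : nat => 1 / INR (S n) ^ 3).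

Definition Catalan : R := Series (fun n : nat => (-1) ^ n / (2 * INR n + 1) ^ 2).

(* Integrals over (0, 1] are improper at 0: the limit of the Riemann integral
   over [a, 1] as a -> 0+.  The value of the integrand at 0 plays no role, and
   integrands unbounded near 0 are allowed. [RInt_gen] is total, so
   [ex_RInt01 f] has to be stated separately where convergence is meant. *)
Definition RInt01 (f : R -> R) : R := RInt_gen f (at_right 0) (at_point 1).

Definition ex_RInt01 (f : R -> R) : Prop :=
  ex_RInt_gen f (at_right 0) (at_point 1).

(* Main.v *)
(* The substitution [u = 2 atan t] turns the integral of [(atan t)^m / t] over
   (0, 1] into [2^-m] times that of [u^m / sin u] over (0, PI/2].  There
   [1 / sin u = 2 sum_(k <= N) sin ((2k+1) u) + cos (2(N+1)u) / sin u]; the terms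
   of the sum integrate to the terms of the series of Catalan's constant and of
   the odd part of zeta(3), and since [u^m / sin u] is monotone, an integration
   by parts shows that the last term contributes O(1/N).

   For the logarithmic integral put [x = 1/(1+t)] and [y = t/(1+t) = 1 - x].
   Up to the derivative of [ln x ln y (ln x - ln y) / 2] the integrand is
   [w(x) + w(y)] over [(1+t)^2], with [w(z) = (ln z)^2 / (2 (1 - z))].  Expanding
   [1 / (1 - z)] geometrically, the k-th terms at [x] and [y] together integrate
   to that of [z^k (ln z)^2 / 2] over [0, 1], which is [1 / (k+1)^3], and
   [z w(z) <= 2] bounds the remainder by 2/(N+1). *)
Require Import Defs.
From Stdlib Require Import Reals Lra Lia Psatz.
From Coquelicot Require Import Coquelicot.
Open Scope R_scope.

(** * Improper integrals as limits at 0+, and termwise passage to the limit *)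

Lemma is_RInt_gen_at_right_0 (f F : R -> R) (l : R) :
  (forall a, 0 < a < 1 -> is_RInt f a 1 (F a)) ->
  filterlim F (at_right 0) (locally l) ->
  is_RInt_gen f (at_right 0) (at_point 1) l.
Proof.
intros HF Hl P HP.
apply Filter_prod with (Q := fun a => 0 < a < 1 /\ P (F a)) (R := fun b => b = 1).
- apply filter_and; [| exact (Hl P HP)].
  exists (mkposreal 1 Rlt_0_1); intros y Hy Hy0.
  change (Rabs (y - 0) < 1) in Hy; apply Rabs_def2 in Hy; lra.
- reflexivity.
- intros a b [Ha HPa] ->; exists (F a); split; [apply HF, Ha | exact HPa].
Qed.

(** Exchange of limit and sum by an eps/3 argument: the remainder bound is uniform in [a], so [N] is
    fixed first, making the remainder and the tail of the series small, and only then does [a] tend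
    to 0. *)
Lemma filterlim_series_remainder (F : R -> R) (T : nat -> R -> R) (s : nat -> R) (l C : R) :
  (forall k, filterlim (T k) (at_right 0) (locally (s k))) ->
  is_series s l ->
  (forall N a, 0 < a < 1 -> Rabs (F a - sum_n (fun k => T k a) N) <= C / INR (S N)) ->
  filterlim F (at_right 0) (locally l).
Proof.
intros HT Hs HR.
assert (HTN : forall N, filterlim (fun a => sum_n (fun k => T k a) N) (at_right 0)
                (locally (sum_n s N))).
{ induction N as [|N IH].
  - rewrite sum_O.
    apply (filterlim_ext (T 0%nat)); [intros a; now rewrite sum_O | apply HT].
  - rewrite sum_Sn.
    apply (filterlim_ext (fun a => plus (sum_n (fun k => T k a) N) (T (S N) a)));
      [intros a; now rewrite sum_Sn |].
    eapply filterlim_comp_2; [exact IH | exact (HT (S N)) | apply @filterlim_plus]. }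
apply filterlim_locally; intros eps.
assert (H3 : 0 < eps / 3) by (destruct eps; simpl; lra).
assert (HC : is_lim_seq (fun N => C / INR (S N)) 0).
{ replace (Finite 0) with (Rbar_mult C 0) by (simpl; f_equal; ring).
  apply is_lim_seq_scal_l.
  apply (is_lim_seq_incr_1 (fun n => / INR n)).
  replace (Finite 0) with (Rbar_inv p_infty) by reflexivity.
  apply is_lim_seq_inv; [apply is_lim_seq_INR | discriminate]. }
apply is_lim_seq_spec in HC.
destruct (HC (mkposreal _ H3)) as [N1 HN1].
assert (Hs' : is_lim_seq (sum_n s) l) by exact Hs.
apply is_lim_seq_spec in Hs'.
destruct (Hs' (mkposreal _ H3)) as [N2 HN2].
set (N := Nat.max N1 N2).
specialize (HN1 N (Nat.le_max_l _ _)); specialize (HN2 N (Nat.le_max_r _ _)).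
simpl pos in HN1, HN2.
specialize (HTN N).
assert (HTa : at_right 0 (fun a => Rabs (sum_n (fun k => T k a) N - sum_n s N) < eps / 3)).
{ apply (HTN (fun y => Rabs (y - sum_n s N) < eps / 3)).
  exists (mkposreal _ H3); intros y Hy; exact Hy. }
assert (H01 : at_right 0 (fun a => 0 < a < 1)).
{ exists (mkposreal 1 Rlt_0_1); intros y Hy Hy0.
  change (Rabs (y - 0) < 1) in Hy; apply Rabs_def2 in Hy; lra. }
generalize (filter_and _ _ HTa H01); apply filter_imp; intros a [Ha Ha01].
specialize (HR N a Ha01).
change (Rabs (F a - l) < eps).
rewrite Rminus_0_r in HN1.
generalize (Rle_abs (C / INR (S N))); intros HCabs.
apply Rabs_def2 in Ha; apply Rabs_def2 in HN2; apply Rabs_le_between in HR.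
apply Rabs_def1; lra.
Qed.

(** * Convergence of the series for zeta(3), Catalan's constant and the odd cubes *)

(** The increasing partial sums stay below 2 - 1/(n+1), by comparison with the telescoping sum of
    1/x - 1/(x+1). *)
Lemma ex_series_inv_sqr : ex_series (fun n => 1 / INR (S n) ^ 2).
Proof.
assert (H : ex_finite_lim_seq (sum_n (fun n => 1 / INR (S n) ^ 2))).
{ apply ex_finite_lim_seq_incr with 2.
  - intros n; rewrite sum_Sn;
    assert (0 < INR (S (S n))) by (apply lt_0_INR; lia).
    assert (0 < 1 / INR (S (S n)) ^ 2) by (apply Rdiv_lt_0_compat; [lra | now apply pow_lt]).
    change (sum_n (fun n => 1 / INR (S n) ^ 2) n <= sum_n (fun n => 1 / INR (S n) ^ 2) n + 1 / INR (S (S n)) ^ 2).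
    lra.
  - assert (forall n, sum_n (fun n => 1 / INR (S n) ^ 2) n <= 2 - 1 / INR (S n)) as Hb.
    { induction n as [|n IH].
      - rewrite sum_O; simpl; lra.
      - rewrite sum_Sn.
        change (sum_n (fun n => 1 / INR (S n) ^ 2) n + 1 / INR (S (S n)) ^ 2 <= 2 - 1 / INR (S (S n))).
        rewrite (S_INR (S n)).
        assert (Hp : 0 < INR (S n)) by (apply lt_0_INR; lia).
        set (x := INR (S n)) in *.
        assert (1 / x - 1 / (x + 1) - 1 / (x + 1) ^ 2 = 1 / (x * (x + 1) ^ 2)) by (field; lra).
        assert (0 < 1 / (x * (x + 1) ^ 2)) by (apply Rdiv_lt_0_compat; [lra | apply Rmult_lt_0_compat; [|apply pow_lt]; lra]).
        lra. }
    intros n; specialize (Hb n).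
    assert (0 < 1 / INR (S n)) by (apply Rdiv_lt_0_compat; [lra | apply lt_0_INR; lia]).
    lra. }
destruct H as [l Hl]; exists l; exact Hl.
Qed.


(** [Series] is total, so its value means a sum only once convergence is known; here it follows by
    comparison with inverse squares. *)
Lemma is_series_zeta3 : is_series (fun n => 1 / INR (S n) ^ 3) zeta3.
Proof.
apply Series_correct, (@ex_series_le R_AbsRing R_CompleteNormedModule _ (fun n => 1 / INR (S n) ^ 2));
  [| exact ex_series_inv_sqr].
intros n; change (Rabs (1 / INR (S n) ^ 3) <= 1 / INR (S n) ^ 2).
assert (Hn : 1 <= INR (S n)) by (rewrite S_INR; generalize (pos_INR n); lra).
assert (0 < INR (S n) ^ 2) by (apply pow_lt; lra).
assert (0 < INR (S n) ^ 3) by (apply pow_lt; lra).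
rewrite Rabs_pos_eq by (apply Rlt_le, Rdiv_lt_0_compat; lra).
apply Rmult_le_compat_l, Rinv_le_contravar; [lra | lra |].
change (INR (S n) ^ 2 <= INR (S n) * INR (S n) ^ 2); nra.
Qed.

Lemma is_series_Catalan : is_series (fun n => (-1) ^ n / (2 * INR n + 1) ^ 2) Catalan.
Proof.
apply Series_correct, (@ex_series_le R_AbsRing R_CompleteNormedModule _ (fun n => 1 / INR (S n) ^ 2));
  [| exact ex_series_inv_sqr].
intros n; change (Rabs ((-1) ^ n / (2 * INR n + 1) ^ 2) <= 1 / INR (S n) ^ 2).
generalize (pos_INR n); intros Hn; rewrite S_INR.
assert (0 < (INR n + 1) ^ 2) by (apply pow_lt; lra).
unfold Rdiv; rewrite Rabs_mult, pow_1_abs.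
rewrite Rabs_pos_eq by (apply Rlt_le, Rinv_0_lt_compat, pow_lt; lra).
apply Rmult_le_compat_l, Rinv_le_contravar; [lra | lra |].
apply pow_incr; lra.
Qed.

Lemma is_series_odd_inv_cube :
  is_series (fun n => 1 / (2 * INR n + 1) ^ 3) (7 / 8 * zeta3).
Proof.
(* [sum_n] includes its last index: the denominators run over 1..2N+2, and the even ones among them
   contribute 1/8 of the sum over 1..N+1. *)
assert (Hsplit : forall N, sum_n (fun n => 1 / (2 * INR n + 1) ^ 3) N =
   sum_n (fun n => 1 / INR (S n) ^ 3) (2 * N + 1)
   - / 8 * sum_n (fun n => 1 / INR (S n) ^ 3) N :> R).
{ induction N as [|N IH].
  - change (2 * 0 + 1)%nat with 1%nat; rewrite sum_Sn, !sum_O.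
    change plus with Rplus; simpl; field.
  - replace (2 * S N + 1)%nat with (S (S (2 * N + 1))) by lia.
    rewrite !sum_Sn, IH; change plus with Rplus; cbv beta.
    replace (INR (S (S (S (2 * N + 1))))) with (2 * INR (S (S N)))
      by (rewrite !S_INR, plus_INR, mult_INR; simpl; ring).
    replace (INR (S (S (2 * N + 1)))) with (2 * INR (S N) + 1)
      by (rewrite !S_INR, plus_INR, mult_INR; simpl; ring).
    assert (0 < INR (S N)) by (apply lt_0_INR; lia).
    assert (0 < INR (S (S N))) by (apply lt_0_INR; lia).
    field; lra. }
assert (Hz : is_lim_seq (sum_n (fun n => 1 / INR (S n) ^ 3)) zeta3)
  by exact is_series_zeta3.
change (is_lim_seq (sum_n (fun n => 1 / (2 * INR n + 1) ^ 3)) (7 / 8 * zeta3)).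
apply (is_lim_seq_ext _ _ _ (fun N => eq_sym (Hsplit N))).
replace (7 / 8 * zeta3) with (zeta3 - / 8 * zeta3) by field.
apply is_lim_seq_minus'.
- apply (is_lim_seq_subseq _ _ (fun N => (2 * N + 1)%nat)); [| exact Hz].
  apply eventually_subseq; intros n; lia.
- now apply (is_lim_seq_scal_l _ (/ 8) zeta3).
Qed.

(** * Integrals of q(u) / sin u by the Dirichlet kernel *)

(** Integration by parts against sin(Mu)/M: the boundary terms are at most (g b + g a)/M, and since
    g' >= 0 the remaining integral is at most (g b - g a)/M. *)
Lemma Rabs_is_RInt_mul_cos (g dg : R -> R) (a b M I : R) :
  a <= b -> 0 < M -> 0 <= g a ->
  (forall u, a <= u <= b -> is_derive g u (dg u)) ->
  (forall u, a <= u <= b -> continuous dg u) ->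
  (forall u, a <= u <= b -> 0 <= dg u) ->
  is_RInt (fun u => g u * cos (M * u)) a b I ->
  Rabs I <= 2 * g b / M.
Proof.
intros Hab HM Hga Hd Hc Hp HI.
assert (Hdg : is_RInt dg a b (g b - g a)).
{ apply (is_RInt_derive g dg); rewrite Rmin_left, Rmax_right; auto. }
assert (Hparts : is_RInt (fun u => dg u * (sin (M * u) / M) + g u * cos (M * u)) a b
                   (g b * (sin (M * b) / M) - g a * (sin (M * a) / M))).
{ apply (is_RInt_derive (fun u => g u * (sin (M * u) / M))); rewrite Rmin_left, Rmax_right by easy;
    intros u Hu.
  - apply (is_derive_mult g (fun u => sin (M * u) / M)).
    + now apply Hd.
    + auto_derive; [easy | field; lra].
    + intros; apply Rmult_comm.
  - assert (continuous g u) by (apply (ex_derive_continuous g); exists (dg u); now apply Hd).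
    apply (continuous_plus (fun u => dg u * (sin (M * u) / M)) (fun u => g u * cos (M * u))).
    + apply (continuous_mult dg); [now apply Hc |].
      apply @ex_derive_continuous; auto_derive; lra.
    + apply (continuous_mult g); [easy |].
      apply @ex_derive_continuous; auto_derive; easy. }
assert (HJ := is_RInt_minus _ _ _ _ _ _ Hparts HI).
assert (HK := is_RInt_scal _ _ _ (/ M) _ Hdg).
assert (HM' : 0 < / M) by now apply Rinv_0_lt_compat.
assert (HJK : Rabs (g b * (sin (M * b) / M) - g a * (sin (M * a) / M) - I)
              <= / M * (g b - g a)).
{ apply (norm_RInt_le _ _ _ _ _ _ Hab) with (2 := HJ) (3 := HK).
  intros u Hu.
  change (Rabs (dg u * (sin (M * u) / M) + g u * cos (M * u) - g u * cos (M * u)) <= / M * dg u).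
  replace (dg u * (sin (M * u) / M) + g u * cos (M * u) - g u * cos (M * u))
    with (/ M * dg u * sin (M * u)) by (field; lra).
  assert (0 <= / M * dg u) by (apply Rmult_le_pos; [lra | auto]).
  rewrite Rabs_mult, (Rabs_pos_eq (/ M * dg u)) by easy.
  assert (Rabs (sin (M * u)) <= 1) by (apply Rabs_le, SIN_bound).
  nra. }
assert (Hgb : 0 <= g b).
{ assert (0 <= g b - g a); [| lra].
  apply (is_RInt_ge_0 dg a b _ Hab Hdg); intros; apply Hp; lra. }
apply Rabs_le_between in HJK.
destruct (SIN_bound (M * b)), (SIN_bound (M * a)).
assert (- (g b * / M) <= g b * (sin (M * b) / M) <= g b * / M) by
  (unfold Rdiv; split; assert (0 <= g b * / M) by (apply Rmult_le_pos; lra); nra).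
assert (- (g a * / M) <= g a * (sin (M * a) / M) <= g a * / M) by
  (unfold Rdiv; split; assert (0 <= g a * / M) by (apply Rmult_le_pos; lra); nra).
unfold Rdiv; apply Rabs_le; lra.
Qed.

(** Telescoping of 2 sin((2k+1)u) sin u = cos(2ku) - cos(2(k+1)u), starting from cos 0 = 1. *)
Lemma inv_sin_dirichlet (u : R) (N : nat) : sin u <> 0 ->
  / sin u = sum_n (fun k => 2 * sin ((2 * INR k + 1) * u)) N
            + cos (2 * INR (S N) * u) / sin u.
Proof.
intros Hs.
assert (Hk : forall k, 2 * sin ((2 * INR k + 1) * u)
                       = (cos (2 * INR k * u) - cos (2 * INR (S k) * u)) / sin u).
{ intros k; rewrite S_INR.
  replace (2 * INR k * u) with ((2 * INR k + 1) * u - u) by ring.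
  replace (2 * (INR k + 1) * u) with ((2 * INR k + 1) * u + u) by ring.
  rewrite cos_minus, cos_plus; field; easy. }
induction N as [|N IH].
- rewrite sum_O, Hk; simpl; replace (2 * 0 * u) with 0 by ring; rewrite cos_0; field; easy.
- rewrite sum_Sn; change plus with Rplus; cbv beta; rewrite Hk, IH; field; easy.
Qed.

Lemma continuous_filterlim_at_right (f : R -> R) (x : R) :
  continuous f x -> filterlim f (at_right x) (locally (f x)).
Proof.
intros Hf P HP; apply filter_le_within; exact (Hf P HP).
Qed.

(** The inequality between [q u * cos u] and [dq u * sin u] says that q / sin is nondecreasing, and
    [V k] is a primitive for the k-th kernel term. The kernel terms give the series; the rest is an
    oscillating integral of order 1/N, uniformly in [a]. *)
Lemma filterlim_RInt_div_sin (q dq : R -> R) (V : nat -> R -> R) (l : R) :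
  (forall u, is_derive q u (dq u)) ->
  (forall u, continuous dq u) ->
  (forall u, 0 <= u <= PI / 2 -> 0 <= q u) ->
  (forall u, 0 <= u <= PI / 2 -> q u * cos u <= dq u * sin u) ->
  (forall k u, is_derive (V k) u (q u * sin ((2 * INR k + 1) * u))) ->
  is_series (fun k => 2 * (V k (PI / 2) - V k 0)) l ->
  filterlim (fun a => RInt (fun u => q u / sin u) a (PI / 2)) (at_right 0) (locally l).
Proof.
intros Hq Hdq Hq0 Hmono HV Hl.
assert (HVc : forall k u, continuous (V k) u).
{ intros k u; apply (ex_derive_continuous (V k)); eexists; apply HV. }
assert (Hqc : forall u, continuous q u).
{ intros u; apply (ex_derive_continuous q); eexists; apply Hq. }
apply (filterlim_series_remainder _ (fun k a => 2 * (V k (PI / 2) - V k a))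
         (fun k => 2 * (V k (PI / 2) - V k 0)) l (q (PI / 2))); [| exact Hl |].
{ intros k.
  apply (continuous_filterlim_at_right (fun a => 2 * (V k (PI / 2) - V k a))).
  apply (continuous_scal_r 2 (fun a => V k (PI / 2) - V k a)).
  apply (continuous_minus (fun _ => V k (PI / 2)) (V k)); [apply continuous_const | apply HVc]. }
intros N a Ha.
assert (HPI : a < PI / 2) by (generalize PI2_1; lra).
assert (Hsin : forall u, a <= u <= PI / 2 -> 0 < sin u).
{ intros u Hu; apply sin_gt_0; lra. }
set (g := fun u => q u / sin u).
(* The quotient rule, written as a product so that continuity and sign can be read off factor by
   factor. *)
set (dg := fun u => (dq u * sin u - q u * cos u) * / (sin u * sin u)).
assert (Hg : forall u, a <= u <= PI / 2 -> is_derive g u (dg u)).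
{ intros u Hu; specialize (Hsin u Hu).
  replace (dg u) with ((dq u * sin u - q u * cos u) / sin u ^ 2)
    by (unfold dg; field; lra).
  apply is_derive_div; [apply Hq | apply is_derive_Reals, derivable_pt_lim_sin | lra]. }
assert (HgI : is_RInt g a (PI / 2) (RInt g a (PI / 2))).
{ apply (RInt_correct (V := R_CompleteNormedModule)), (ex_RInt_continuous (V := R_CompleteNormedModule)).
  rewrite Rmin_left, Rmax_right by lra; intros u Hu.
  apply (ex_derive_continuous g); eexists; now apply Hg. }
assert (HSI : is_RInt (fun u => q u * sum_n (fun k => 2 * sin ((2 * INR k + 1) * u)) N)
                a (PI / 2) (sum_n (fun k => 2 * (V k (PI / 2) - V k a)) N)).
{ assert (Hk : forall k, is_RInt (fun u => q u * (2 * sin ((2 * INR k + 1) * u)))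
                 a (PI / 2) (2 * (V k (PI / 2) - V k a))).
  { intros k.
    apply (is_RInt_ext (fun u => scal 2 (q u * sin ((2 * INR k + 1) * u)))).
    { intros u _; change (2 * (q u * sin ((2 * INR k + 1) * u)) = q u * (2 * sin ((2 * INR k + 1) * u)));
        ring. }
    apply (is_RInt_scal (V := R_NormedModule)).
    apply (is_RInt_derive (V k)).
    - intros; apply HV.
    - intros u _; apply (continuous_mult q); [apply Hqc |].
      apply @ex_derive_continuous; auto_derive; easy. }
  induction N as [|N IH].
  - rewrite sum_O.
    apply (is_RInt_ext (fun u => q u * (2 * sin ((2 * INR 0 + 1) * u)))); [| apply Hk].
    intros u _; now rewrite sum_O.
  - rewrite sum_Sn.
    apply (is_RInt_ext (fun u => plus (q u * sum_n (fun k => 2 * sin ((2 * INR k + 1) * u)) N)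
                                   (q u * (2 * sin ((2 * INR (S N) + 1) * u))))).
    { intros u _; rewrite sum_Sn; exact (eq_sym (Rmult_plus_distr_l _ _ _)). }
    apply (is_RInt_plus (V := R_NormedModule)); [exact IH | apply Hk]. }
assert (HN : 0 < 2 * INR (S N)) by (assert (0 < INR (S N)) by (apply lt_0_INR; lia); lra).
(* The frequency is M = 2(N+1), and sin(PI/2) = 1 identifies g with q at the upper end. *)
replace (q (PI / 2) / INR (S N)) with (2 * g (PI / 2) / (2 * INR (S N)))
  by (unfold g; rewrite sin_PI2; field; lra).
apply (Rabs_is_RInt_mul_cos g dg a); auto; try lra.
- apply Rlt_le in HPI; unfold g; apply Rmult_le_pos;
    [apply Hq0; lra | apply Rlt_le, Rinv_0_lt_compat, Hsin; lra].
- intros u Hu; specialize (Hsin u Hu).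
  apply (continuous_mult (fun u => dq u * sin u - q u * cos u)).
  + apply (continuous_minus (fun u => dq u * sin u) (fun u => q u * cos u)).
    * apply (continuous_mult dq); [apply Hdq | apply continuous_sin].
    * apply (continuous_mult q); [apply Hqc | apply continuous_cos].
  + apply @ex_derive_continuous; auto_derive; nra.
- intros u Hu; specialize (Hsin u Hu).
  apply Rmult_le_pos; [generalize (Hmono u); lra | apply Rlt_le, Rinv_0_lt_compat; nra].
- apply (is_RInt_ext (fun u => minus (g u) (q u * sum_n (fun k => 2 * sin ((2 * INR k + 1) * u)) N))).
  { rewrite Rmin_left, Rmax_right by lra; intros u Hu.
    assert (Hs : 0 < sin u) by (apply Hsin; lra).
    assert (E := inv_sin_dirichlet u N (Rgt_not_eq _ _ Hs)).
    change (g u - q u * sum_n (fun k => 2 * sin ((2 * INR k + 1) * u)) N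
            = g u * cos (2 * INR (S N) * u)).
    unfold g, Rdiv; rewrite E at 1; field; lra. }
  exact (is_RInt_minus _ _ _ _ _ _ HgI HSI).
Qed.

(** * The cases q(u) = u and q(u) = u^2 *)

Lemma sin_odd_PI2 (k : nat) : sin ((2 * INR k + 1) * (PI / 2)) = (-1) ^ k.
Proof.
induction k as [|k IH].
- simpl; rewrite Rmult_0_r, Rplus_0_l, Rmult_1_l; apply sin_PI2.
- rewrite S_INR.
  replace ((2 * (INR k + 1) + 1) * (PI / 2)) with ((2 * INR k + 1) * (PI / 2) + PI) by field.
  rewrite neg_sin, IH; simpl; ring.
Qed.

Lemma cos_odd_PI2 (k : nat) : cos ((2 * INR k + 1) * (PI / 2)) = 0.
Proof.
induction k as [|k IH].
- simpl; rewrite Rmult_0_r, Rplus_0_l, Rmult_1_l; apply cos_PI2.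
- rewrite S_INR.
  replace ((2 * (INR k + 1) + 1) * (PI / 2)) with ((2 * INR k + 1) * (PI / 2) + PI) by field.
  rewrite neg_cos, IH; ring.
Qed.

(** Mean value theorem for sin u - u cos u, whose derivative u sin u is nonnegative. This is the
    monotonicity of u / sin u. *)
Lemma mul_cos_le_sin (u : R) : 0 <= u <= PI / 2 -> u * cos u <= sin u.
Proof.
intros Hu.
destruct (MVT_gen (fun u => sin u - u * cos u) 0 u (fun u => u * sin u)) as [c [Hc E]].
- intros x _; auto_derive; [easy | ring].
- intros x _; apply continuity_pt_filterlim, (ex_derive_continuous (fun u => sin u - u * cos u)); auto_derive; easy.
- rewrite Rmin_left, Rmax_right in Hc by lra; rewrite sin_0 in E.
  assert (0 <= sin c) by (apply sin_ge_0; lra).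
  assert (0 <= c * sin c * (u - 0)) by (apply Rmult_le_pos; [apply Rmult_le_pos |]; lra).
  lra.
Qed.

(** The primitive comes from one integration by parts; it vanishes at 0, and at PI/2 only the sine
    term survives, with value (-1)^k / (2k+1)^2. *)
Lemma filterlim_RInt_id_div_sin :
  filterlim (fun a => RInt (fun u => u / sin u) a (PI / 2)) (at_right 0) (locally (2 * Catalan)).
Proof.
apply (filterlim_RInt_div_sin (fun u => u) (fun _ => 1)
  (fun k u => - u * cos ((2 * INR k + 1) * u) / (2 * INR k + 1)
              + sin ((2 * INR k + 1) * u) / (2 * INR k + 1) ^ 2)).
- intros u; auto_derive; [easy | ring].
- intros u; apply continuous_const.
- tauto.
- intros u Hu; rewrite Rmult_1_l; now apply mul_cos_le_sin.
- intros k u; generalize (pos_INR k); intros Hk.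
  auto_derive; [easy | field; lra].
- apply (is_series_ext (fun k => scal 2 ((-1) ^ k / (2 * INR k + 1) ^ 2))).
  { intros k; generalize (pos_INR k); intros Hk.
    rewrite sin_odd_PI2, cos_odd_PI2, (Rmult_0_r (2 * INR k + 1)), sin_0, cos_0.
    change (2 * ((-1) ^ k / (2 * INR k + 1) ^ 2) = 
      2 * (- (PI / 2) * 0 / (2 * INR k + 1) + (-1) ^ k / (2 * INR k + 1) ^ 2 -
       (- 0 * 1 / (2 * INR k + 1) + 0 / (2 * INR k + 1) ^ 2))).
    field; lra. }
  apply (is_series_scal_l 2 (fun k => (-1) ^ k / (2 * INR k + 1) ^ 2)), is_series_Catalan.
Qed.

(** Two integrations by parts give the primitive. Its value at PI/2 is PI (-1)^k / (2k+1)^2, the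
    source of Catalan's constant; its value at 0 is 2 / (2k+1)^3, the source of zeta(3). *)
Lemma filterlim_RInt_sqr_div_sin :
  filterlim (fun a => RInt (fun u => u ^ 2 / sin u) a (PI / 2)) (at_right 0)
    (locally (2 * PI * Catalan - 7 / 2 * zeta3)).
Proof.
apply (filterlim_RInt_div_sin (fun u => u ^ 2) (fun u => 2 * u)
  (fun k u => - u ^ 2 * cos ((2 * INR k + 1) * u) / (2 * INR k + 1)
              + 2 * u * sin ((2 * INR k + 1) * u) / (2 * INR k + 1) ^ 2
              + 2 * cos ((2 * INR k + 1) * u) / (2 * INR k + 1) ^ 3)).
- intros u; auto_derive; [easy | ring].
- intros u; apply @ex_derive_continuous; auto_derive; easy.
- intros u _; apply pow2_ge_0.
- intros u Hu; generalize (mul_cos_le_sin u Hu).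
  assert (0 <= sin u) by (apply sin_ge_0; lra); nra.
- intros k u; generalize (pos_INR k); intros Hk.
  auto_derive; [easy | field; lra].
- apply (is_series_ext (fun k => minus (scal (2 * PI) ((-1) ^ k / (2 * INR k + 1) ^ 2))
                                   (scal 4 (1 / (2 * INR k + 1) ^ 3)))).
  { intros k; generalize (pos_INR k); intros Hk.
    rewrite sin_odd_PI2, cos_odd_PI2, (Rmult_0_r (2 * INR k + 1)), sin_0, cos_0.
    change (2 * PI * ((-1) ^ k / (2 * INR k + 1) ^ 2) - 4 * (1 / (2 * INR k + 1) ^ 3) =
      2 * (- (PI / 2) ^ 2 * 0 / (2 * INR k + 1) + 2 * (PI / 2) * (-1) ^ k / (2 * INR k + 1) ^ 2
           + 2 * 0 / (2 * INR k + 1) ^ 3 -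
       (- 0 ^ 2 * 1 / (2 * INR k + 1) + 2 * 0 * 0 / (2 * INR k + 1) ^ 2
        + 2 * 1 / (2 * INR k + 1) ^ 3))).
    field; lra. }
  replace (2 * PI * Catalan - 7 / 2 * zeta3) with (2 * PI * Catalan - 4 * (7 / 8 * zeta3)) by field.
  apply (is_series_minus (fun k => scal (2 * PI) ((-1) ^ k / (2 * INR k + 1) ^ 2))).
  + apply (is_series_scal_l (2 * PI) (fun k => (-1) ^ k / (2 * INR k + 1) ^ 2)), is_series_Catalan.
  + apply (is_series_scal_l 4 (fun k => 1 / (2 * INR k + 1) ^ 3)), is_series_odd_inv_cube.
Qed.

(** * The substitution u = 2 atan t *)

Lemma sin_2_atan (t : R) : sin (2 * atan t) = 2 * t / (1 + t ^ 2).
Proof.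
assert (H : 0 < 1 + t²) by (generalize (Rle_0_sqr t); lra).
rewrite sin_2a, sin_atan, cos_atan.
assert (Hs := sqrt_lt_R0 _ H).
replace (1 + t ^ 2) with (sqrt (1 + t²) * sqrt (1 + t²))
  by (rewrite sqrt_sqrt by lra; unfold Rsqr; ring).
field; lra.
Qed.

(** Under u = 2 atan t, du = 2 dt / (1 + t^2) and sin u = 2t / (1 + t^2), so du / sin u = dt / t. *)
Lemma is_RInt_atan_pow_div (m : nat) (a : R) : 0 < a < 1 ->
  is_RInt (fun t => atan t ^ m / t) a 1
    (/ 2 ^ m * RInt (fun u => u ^ m / sin u) (2 * atan a) (PI / 2)).
Proof.
intros Ha.
assert (H2m : 0 < 2 ^ m) by (apply pow_lt; lra).
assert (HC : is_RInt (fun t => scal (2 / (1 + t ^ 2)) ((2 * atan t) ^ m / sin (2 * atan t))) a 1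
  (RInt (fun u => u ^ m / sin u) (2 * atan a) (2 * atan 1))).
{ apply (is_RInt_comp (V := R_CompleteNormedModule) (fun u => u ^ m / sin u)
           (fun t => 2 * atan t) (fun t => 2 / (1 + t ^ 2)));
    rewrite Rmin_left, Rmax_right by lra; intros t Ht.
  - assert (Hs : 0 < sin (2 * atan t))
      by (rewrite sin_2_atan; apply Rdiv_lt_0_compat; nra).
    apply @ex_derive_continuous; auto_derive; lra.
  - split.
    + auto_derive; [easy |]; unfold Rsqr; field; nra.
    + apply @ex_derive_continuous; auto_derive; nra. }
replace (2 * atan 1) with (PI / 2) in HC by (rewrite atan_1; field).
apply (is_RInt_scal _ _ _ (/ 2 ^ m)) in HC.
revert HC; apply is_RInt_ext.
rewrite Rmin_left, Rmax_right by lra; intros t Ht.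
change (/ 2 ^ m * (2 / (1 + t ^ 2) * ((2 * atan t) ^ m / sin (2 * atan t))) = atan t ^ m / t).
rewrite sin_2_atan, Rpow_mult_distr.
field; repeat split; nra.
Qed.

Lemma filterlim_2_atan : filterlim (fun a => 2 * atan a) (at_right 0) (at_right 0).
Proof.
intros P [eps HP].
assert (Hc : continuous (fun a => 2 * atan a) 0)
  by (apply @ex_derive_continuous; auto_derive; easy).
destruct (proj1 (filterlim_locally _ _) Hc eps) as [d Hd].
exists d; intros a Ha Ha0; apply HP.
- specialize (Hd a Ha); now rewrite atan_0, Rmult_0_r in Hd.
- generalize (atan_increasing 0 a Ha0); rewrite atan_0; lra.
Qed.

(** * Logarithmic bounds and limits at 0+ *)

Lemma filterlim_scal_0 (F : (R -> Prop) -> Prop) (f : R -> R) (c : R) :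
  filterlim f F (locally 0) -> filterlim (fun x => c * f x) F (locally 0).
Proof.
intros Hf; rewrite <- (Rmult_0_r c).
exact (filterlim_comp _ _ _ f (scal c) F (locally 0) _ Hf (filterlim_scal_r c 0)).
Qed.

Lemma opp_ln_le (z : R) : 0 < z -> - ln z <= (1 - z) / z.
Proof.
intros Hz; generalize (exp_ineq1_le (- ln z)).
rewrite exp_Ropp, exp_ln by easy.
replace ((1 - z) / z) with (/ z - 1) by (field; lra); lra.
Qed.

Lemma ln_sqr (s : R) : 0 < s -> ln (s ^ 2) = 2 * ln s.
Proof. intros Hs; simpl; rewrite Rmult_1_r, ln_mult by easy; ring. Qed.

(** With s = sqrt z, the left side is 4 (s ln s)^2, and 0 <= - s ln s <= 1 - s. *)
Lemma mul_sqr_ln_le (z : R) : 0 < z <= 1 -> z * ln z ^ 2 <= 4 * (1 - sqrt z) ^ 2.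
Proof.
intros Hz.
assert (Hs : 0 < sqrt z) by (apply sqrt_lt_R0; lra).
assert (Hz2 : z = sqrt z ^ 2) by (rewrite pow2_sqrt; lra).
set (s := sqrt z) in *; clearbody s; subst z.
assert (Hs1 : s <= 1) by nra.
rewrite ln_sqr by easy.
assert (H0 : 0 <= - ln s).
{ generalize (ln_le s 1 Hs Hs1); rewrite ln_1; lra. }
assert (H1 : s * - ln s <= 1 - s).
{ replace (1 - s) with (s * ((1 - s) / s)) by (field; lra).
  apply Rmult_le_compat_l; [lra | now apply opp_ln_le]. }
replace (s ^ 2 * (2 * ln s) ^ 2) with (4 * (s * - ln s) ^ 2) by ring.
apply Rmult_le_compat_l; [lra |].
apply pow_incr; split; [apply Rmult_le_pos; lra | easy].
Qed.

(** With s = sqrt z, (1 - s)^2 <= (1 - s)(1 + s) = 1 - z. For z < 1 this is the bound z w(z) <=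
    2. *)
Lemma mul_sqr_ln_le_sub (z : R) : 0 < z <= 1 -> z * ln z ^ 2 <= 4 * (1 - z).
Proof.
intros Hz; apply (Rle_trans _ _ _ (mul_sqr_ln_le z Hz)).
assert (Hs : 0 < sqrt z) by (apply sqrt_lt_R0; lra).
assert (Hz2 : z = sqrt z ^ 2) by (rewrite pow2_sqrt; lra).
set (s := sqrt z) in *; clearbody s; subst z.
assert (s <= 1) by nra; nra.
Qed.

Lemma filterlim_mul_sqr_ln_0 :
  filterlim (fun z => z * ln z ^ 2) (at_right 0) (locally 0).
Proof.
(* [|ln z| = 4 |ln (z^(1/4))| <= 4 z^(-1/4)] *)
apply (filterlim_le_le (fun _ => 0) _ (fun z => 16 * sqrt z) 0).
- exists (mkposreal 1 Rlt_0_1); intros z Hz Hz0.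
  change (Rabs (z - 0) < 1) in Hz; apply Rabs_def2 in Hz.
  assert (Hs : 0 < sqrt z) by (apply sqrt_lt_R0; lra).
  assert (Hz2 : z = sqrt z ^ 2) by (rewrite pow2_sqrt; lra).
  split; [apply Rmult_le_pos; [lra | apply pow2_ge_0] |].
  set (s := sqrt z) in *; clearbody s; subst z.
  assert (Hs1 : s <= 1) by nra.
  rewrite ln_sqr by easy.
  assert (H := mul_sqr_ln_le s (conj Hs Hs1)).
  assert (Hr : 0 < sqrt s) by now apply sqrt_lt_R0.
  assert (Hr1 : sqrt s <= 1) by (rewrite <- sqrt_1; apply sqrt_le_1_alt, Hs1).
  assert ((1 - sqrt s) ^ 2 <= 1) by nra.
  replace (s ^ 2 * (2 * ln s) ^ 2) with (4 * s * (s * ln s ^ 2)) by ring.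
  nra.
- apply filterlim_const.
- generalize (continuous_filterlim_at_right (fun z => 16 * sqrt z) 0); rewrite sqrt_0, Rmult_0_r.
  intros H; apply H.
  apply (continuous_scal_r 16 sqrt), continuous_sqrt.
Qed.

(* The primitive of [z^k ln^2 z / 2] vanishing at [0+]. *)
Definition half_sqr_ln_primitive (k : nat) (z : R) : R :=
  z ^ S k * (ln z ^ 2 / 2 / INR (S k) - ln z / INR (S k) ^ 2 + 1 / INR (S k) ^ 3).

Lemma is_derive_half_sqr_ln_primitive (k : nat) (z : R) : 0 < z ->
  is_derive (half_sqr_ln_primitive k) z (z ^ k * ln z ^ 2 / 2).
Proof.
intros Hz; unfold half_sqr_ln_primitive.
assert (Hk : 0 < INR (S k)) by (apply lt_0_INR; lia).
set (c := INR (S k)) in *.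
evar_last.
{ apply (is_derive_mult (fun z => z ^ S k)
   (fun z => ln z ^ 2 / 2 / c - ln z / c ^ 2 + 1 / c ^ 3)).
  - apply is_derive_pow, is_derive_id.
  - auto_derive; [easy | reflexivity].
  - intros; apply Rmult_comm. }
fold c; change plus with Rplus; change mult with Rmult; change one with 1; simpl; field; lra.
Qed.

(** Squeeze on (0, 1): with m = - ln z >= 0 and 1/(k+1) <= 1, the bracket lies between 0 and 2(m^2 +
    1), and z^(k+1) <= z. *)
Lemma filterlim_half_sqr_ln_primitive_0 (k : nat) :
  filterlim (half_sqr_ln_primitive k) (at_right 0) (locally 0).
Proof.
apply (filterlim_le_le (fun _ => 0) _ (fun z => 2 * (z * ln z ^ 2 + z)) 0).
- exists (mkposreal 1 Rlt_0_1); intros z Hz Hz0.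
  change (Rabs (z - 0) < 1) in Hz; apply Rabs_def2 in Hz.
  assert (Hl : 0 <= - ln z) by (generalize (ln_le z 1 Hz0 ltac:(lra)); rewrite ln_1; lra).
  unfold half_sqr_ln_primitive.
  assert (Hc : 1 <= INR (S k)) by (rewrite S_INR; generalize (pos_INR k); lra).
  set (c := INR (S k)) in *.
  assert (Hi : 0 < / c <= 1).
  { split; [apply Rinv_0_lt_compat; lra |].
    rewrite <- Rinv_1; apply Rinv_le_contravar; lra. }
  replace (ln z ^ 2 / 2 / c - ln z / c ^ 2 + 1 / c ^ 3)
    with (ln z ^ 2 / 2 * / c + - ln z * (/ c) ^ 2 + (/ c) ^ 3) by (field; lra).
  set (i := / c) in *; set (m := - ln z) in *.
  replace (ln z ^ 2) with (m ^ 2) by (unfold m; ring).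
  assert (Hzk : 0 <= z ^ k <= 1).
  { split; [apply pow_le; lra | rewrite <- (pow1 k); apply pow_incr; lra]. }
  assert (Hi2 : 0 <= i ^ 2 <= 1) by nra.
  assert (Hi3 : 0 <= i ^ 3 <= 1) by (simpl; simpl in Hi2; nra).
  assert (HQ : 0 <= m ^ 2 / 2 * i + m * i ^ 2 + i ^ 3 <= 2 * (m ^ 2 + 1)).
  { assert (0 <= m ^ 2) by apply pow2_ge_0.
    assert (0 <= m ^ 2 / 2 * i <= m ^ 2 / 2) by nra.
    assert (0 <= m * i ^ 2 <= m) by nra.
    assert (m <= 1 + m ^ 2) by nra.
    lra. }
  set (Q := m ^ 2 / 2 * i + m * i ^ 2 + i ^ 3) in *.
  change (z ^ S k) with (z * z ^ k).
  split; [apply Rmult_le_pos; [apply Rmult_le_pos |]; lra |].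
  replace (2 * (z * m ^ 2 + z)) with (z * (1 * (2 * (m ^ 2 + 1)))) by ring.
  rewrite Rmult_assoc; apply Rmult_le_compat_l; [lra |].
  apply Rmult_le_compat; lra.
- apply filterlim_const.
- apply filterlim_scal_0.
  (* Only the 0 in the target [locally 0] becomes 0 + 0, one summand for each limit. *)
  rewrite <- (Rplus_0_l 0) at 2.
  apply (filterlim_comp_2 (G := locally 0) (H := locally 0)); [apply filterlim_mul_sqr_ln_0 | | apply (filterlim_plus 0 0)].
  intros P HP; now apply filter_le_within.
Qed.

(* With [x = 1 / (1 + t)] and [y = t / (1 + t) = 1 - x], this is
   [ln x * ln y * (ln x - ln y) / 2]. *)
Definition log_boundary (t : R) : R := ln (1 + t) * (ln t - ln (1 + t)) * ln t / 2.

(** Put A = ln(1+t), L = ln t and y = t/(1+t), so that ln y = L - A. Then 0 <= A <= t <= 2y, and L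
    <= 0 <= A gives 0 <= L(L - A)/2 <= (L - A)^2. *)
Lemma log_boundary_bounds (t : R) : 0 < t < 1 ->
  0 <= log_boundary t <= 2 * (t / (1 + t) * ln (t / (1 + t)) ^ 2).
Proof.
intros Ht; unfold log_boundary.
rewrite ln_div by lra.
assert (H1t : 0 < 1 + t) by lra.
assert (HA : 0 <= ln (1 + t) <= t).
{ generalize (ln_le 1 (1 + t) Rlt_0_1 ltac:(lra)); rewrite ln_1; intros H; split; [easy |].
  generalize (ln_le _ _ H1t (exp_ineq1_le t)); rewrite ln_exp; lra. }
assert (HL : ln t <= 0) by (generalize (ln_le t 1 ltac:(lra) ltac:(lra)); rewrite ln_1; lra).
set (A := ln (1 + t)) in *; set (L := ln t) in *.
assert (t <= 2 * (t / (1 + t))).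
{ replace t with (t / (1 + t) * (1 + t)) at 1 by (field; lra).
  assert (0 < t / (1 + t)) by (apply Rdiv_lt_0_compat; lra); nra. }
set (y := t / (1 + t)) in *.
assert (H0 : 0 <= (L - A) * L / 2 <= (L - A) ^ 2) by nra.
split; [replace (A * (L - A) * L / 2) with (A * ((L - A) * L / 2)) by field; apply Rmult_le_pos; lra |].
replace (A * (L - A) * L / 2) with (A * ((L - A) * L / 2)) by field.
replace (2 * (y * (L - A) ^ 2)) with (2 * y * (L - A) ^ 2) by ring.
apply Rmult_le_compat; lra.
Qed.

Lemma filterlim_ratio_0 : filterlim (fun t => t / (1 + t)) (at_right 0) (at_right 0).
Proof.
intros P [eps HP]; exists eps; intros t Ht Ht0.
change (Rabs (t - 0) < eps) in Ht; rewrite Rminus_0_r, Rabs_pos_eq in Ht by lra.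
assert (H0 : 0 < t / (1 + t)) by (apply Rdiv_lt_0_compat; lra).
apply HP; [| easy].
change (Rabs (t / (1 + t) - 0) < eps); rewrite Rminus_0_r, Rabs_pos_eq by lra.
assert (t / (1 + t) * (1 + t) = t) by (field; lra); nra.
Qed.

Lemma filterlim_log_boundary_0 : filterlim log_boundary (at_right 0) (locally 0).
Proof.
apply (filterlim_le_le (fun _ => 0) _ (fun t => 2 * (t / (1 + t) * ln (t / (1 + t)) ^ 2)) 0).
- exists (mkposreal 1 Rlt_0_1); intros t Ht Ht0.
  change (Rabs (t - 0) < 1) in Ht; apply Rabs_def2 in Ht.
  apply log_boundary_bounds; lra.
- apply filterlim_const.
- apply (filterlim_comp _ _ _ (fun t => t / (1 + t)) (fun y => 2 * (y * ln y ^ 2)) _ (at_right 0)).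
  + exact filterlim_ratio_0.
  + apply filterlim_scal_0, filterlim_mul_sqr_ln_0.
Qed.

(** * Differentiation of the boundary term and of the partial sums *)

(** With x = 1/(1+t) and y = t/(1+t), the first two terms are w(x) and w(y) over (1+t)^2, for w(z) =
    (ln z)^2 / (2(1 - z)). *)
Lemma is_derive_log_boundary (t : R) : 0 < t ->
  is_derive log_boundary t
    (ln (1 + t) ^ 2 / (2 * t * (1 + t)) + (ln t - ln (1 + t)) ^ 2 / (2 * (1 + t))
     - ln (1 + t) * ln (1 + 1 / t) / t).
Proof.
intros Ht.
replace (1 + 1 / t) with ((1 + t) / t) by (field; lra).
rewrite ln_div by lra.
unfold log_boundary; auto_derive; [lra | field; lra].
Qed.

(** For 0 < t <= 1, the integral of z^k (ln z)^2 / 2 over [t/(1+t), 1/(1+t)], an interval that is a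
    single point at t = 1 and grows to (0, 1) as t tends to 0. *)
Definition log_series_term (k : nat) (t : R) : R :=
  half_sqr_ln_primitive k (1 / (1 + t)) - half_sqr_ln_primitive k (t / (1 + t)).

Lemma is_derive_log_series_term (k : nat) (t : R) : 0 < t ->
  is_derive (log_series_term k) t
   (- ((1 / (1 + t)) ^ k * ln (1 + t) ^ 2
       + (t / (1 + t)) ^ k * (ln t - ln (1 + t)) ^ 2) / (2 * (1 + t) ^ 2)).
Proof.
intros Ht.
assert (Hx : 0 < 1 / (1 + t)) by (apply Rdiv_lt_0_compat; lra).
assert (Hy : 0 < t / (1 + t)) by (apply Rdiv_lt_0_compat; lra).
assert (Dx : is_derive (fun t => half_sqr_ln_primitive k (1 / (1 + t))) t
  (- / (1 + t) ^ 2 * ((1 / (1 + t)) ^ k * ln (1 / (1 + t)) ^ 2 / 2))).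
{ apply (is_derive_comp (half_sqr_ln_primitive k) (fun t => 1 / (1 + t)));
    [now apply is_derive_half_sqr_ln_primitive | auto_derive; [lra | field; lra]]. }
assert (Dy : is_derive (fun t => half_sqr_ln_primitive k (t / (1 + t))) t
  (/ (1 + t) ^ 2 * ((t / (1 + t)) ^ k * ln (t / (1 + t)) ^ 2 / 2))).
{ apply (is_derive_comp (half_sqr_ln_primitive k) (fun t => t / (1 + t)));
    [now apply is_derive_half_sqr_ln_primitive | auto_derive; [lra | field; lra]]. }
assert (D := is_derive_minus _ _ _ _ _ Dx Dy).
rewrite !ln_div, ln_1 in D by lra.
evar_last; [exact D |].
change minus with Rminus; cbv beta.
field; lra.
Qed.

(* [x^N w(x) + y^N w(y)] over [(1 + t)^2], with [w(z) = (ln z)^2 / (2 (1 - z))]. *)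
Definition log_remainder (N : nat) (t : R) : R :=
  (1 / (1 + t)) ^ N * (ln (1 + t) ^ 2 / (2 * t * (1 + t)))
  + (t / (1 + t)) ^ N * ((ln t - ln (1 + t)) ^ 2 / (2 * (1 + t))).

(** The finite geometric sum turns the derivative of the partial sum into minus (1 - z^(N+1)) w(z) /
    (1+t)^2, added over z = x, y. The boundary derivative cancels all but the powers z^(N+1). *)
Lemma is_derive_log_partial_sum (N : nat) (t : R) : 0 < t ->
  is_derive (fun t => - (log_boundary t + sum_n (fun k => log_series_term k t) N)) t
    (ln (1 + t) * ln (1 + 1 / t) / t - log_remainder (S N) t).
Proof.
intros Ht; unfold log_remainder.
assert (HN : is_derive (fun t => sum_n (fun k => log_series_term k t) N) t
  (- ((1 - (1 / (1 + t)) ^ S N) * (ln (1 + t) ^ 2 / (2 * t * (1 + t)))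
     + (1 - (t / (1 + t)) ^ S N) * ((ln t - ln (1 + t)) ^ 2 / (2 * (1 + t)))))).
{ induction N as [|N IH].
  - apply (is_derive_ext (log_series_term 0)); [intros; now rewrite sum_O |].
    evar_last; [now apply is_derive_log_series_term |].
    simpl; field; lra.
  - apply (is_derive_ext (fun t => plus (sum_n (fun k => log_series_term k t) N) (log_series_term (S N) t)));
      [intros; now rewrite sum_Sn |].
    evar_last; [apply @is_derive_plus; [exact IH | now apply is_derive_log_series_term] |].
    change plus with Rplus; cbv beta; simpl; field; lra. }
evar_last.
{ apply @is_derive_opp, @is_derive_plus; [now apply is_derive_log_boundary | exact HN]. }
change opp with Ropp; change plus with Rplus; cbv beta; ring.
Qed.

(** One of the N+1 factors z is spent on z w(z) <= 2, which leaves z^N for z = x, y. *)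
Lemma log_remainder_bounds (N : nat) (t : R) : 0 < t <= 1 ->
  0 <= log_remainder (S N) t
    <= 2 * ((1 / (1 + t)) ^ N + (t / (1 + t)) ^ N) / (1 + t) ^ 2.
Proof.
intros Ht; unfold log_remainder.
assert (Hx : 0 < 1 / (1 + t)) by (apply Rdiv_lt_0_compat; lra).
assert (Hy : 0 < t / (1 + t)) by (apply Rdiv_lt_0_compat; lra).
assert (Hxy : 1 / (1 + t) = 1 - t / (1 + t)) by (field; lra).
assert (HX := mul_sqr_ln_le_sub (1 / (1 + t)) ltac:(lra)).
assert (HY := mul_sqr_ln_le_sub (t / (1 + t)) ltac:(lra)).
rewrite ln_div, ln_1 in HX by lra; rewrite ln_div in HY by lra.
assert (Hi : 0 < / (1 + t) ^ 2) by (apply Rinv_0_lt_compat, pow_lt; lra).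
assert (HX' : 0 <= 1 / (1 + t) * (ln (1 + t) ^ 2 / (2 * t * (1 + t))) <= 2 / (1 + t) ^ 2).
{ split.
  - apply Rmult_le_pos; [lra |]; apply Rdiv_le_0_compat; [apply pow2_ge_0 | nra].
  - replace (1 / (1 + t) * (ln (1 + t) ^ 2 / (2 * t * (1 + t))))
      with (1 / (1 + t) * (0 - ln (1 + t)) ^ 2 / (2 * t * (1 + t))) by (field; lra).
    replace (2 / (1 + t) ^ 2) with (4 * (1 - 1 / (1 + t)) / (2 * t * (1 + t))) by (field; lra).
    apply Rmult_le_compat_r; [apply Rlt_le, Rinv_0_lt_compat; nra | exact HX]. }
assert (HY' : 0 <= t / (1 + t) * ((ln t - ln (1 + t)) ^ 2 / (2 * (1 + t))) <= 2 / (1 + t) ^ 2).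
{ split.
  - apply Rmult_le_pos; [lra |]; apply Rdiv_le_0_compat; [apply pow2_ge_0 | nra].
  - replace (t / (1 + t) * ((ln t - ln (1 + t)) ^ 2 / (2 * (1 + t))))
      with (t / (1 + t) * (ln t - ln (1 + t)) ^ 2 / (2 * (1 + t))) by (field; lra).
    replace (2 / (1 + t) ^ 2) with (4 * (1 - t / (1 + t)) / (2 * (1 + t))) by (field; lra).
    apply Rmult_le_compat_r; [apply Rlt_le, Rinv_0_lt_compat; nra | exact HY]. }
assert (HxN := pow_lt _ N Hx); assert (HyN := pow_lt _ N Hy).
simpl pow in *.
set (X := 1 / (1 + t)) in *; set (Y := t / (1 + t)) in *.
set (U := ln (1 + t) * (ln (1 + t) * 1) / (2 * t * (1 + t))) in *.
set (W := (ln t - ln (1 + t)) * ((ln t - ln (1 + t)) * 1) / (2 * (1 + t))) in *.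
set (D := (1 + t) * ((1 + t) * 1)) in *.
replace (X * X ^ N * U) with (X ^ N * (X * U)) by ring.
replace (Y * Y ^ N * W) with (Y ^ N * (Y * W)) by ring.
replace (2 * (X ^ N + Y ^ N) / D) with (X ^ N * (2 / D) + Y ^ N * (2 / D)) by (unfold Rdiv; ring).
split.
- apply Rplus_le_le_0_compat; apply Rmult_le_pos; lra.
- apply Rplus_le_compat; apply Rmult_le_compat_l; lra.
Qed.

(** * The logarithmic integral over [a, 1] and its limit *)

Lemma continuous_log_integrand (t : R) : 0 < t ->
  continuous (fun t => ln (1 + t) * ln (1 + 1 / t) / t) t.
Proof.
intros Ht; assert (0 < / t) by now apply Rinv_0_lt_compat.
apply @ex_derive_continuous; auto_derive; repeat split; lra.
Qed.

(** The difference is exactly the integral of [log_remainder (S N)] over [a, 1], whose majorant has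
    an explicit primitive. *)
Lemma log_integral_sub_partial_sum (N : nat) (a : R) : 0 < a < 1 ->
  Rabs (RInt (fun t => ln (1 + t) * ln (1 + 1 / t) / t) a 1
        - log_boundary a - sum_n (fun k => log_series_term k a) N) <= 2 / INR (S N).
Proof.
intros Ha; set (f := fun t => ln (1 + t) * ln (1 + 1 / t) / t).
assert (HN : 0 < INR (S N)) by (apply lt_0_INR; lia).
assert (Hcr : forall t, 0 < t -> continuous (log_remainder (S N)) t).
{ intros t Ht.
  assert (0 < t * / (1 + t)) by (apply Rmult_lt_0_compat; [| apply Rinv_0_lt_compat]; lra).
  apply @ex_derive_continuous; unfold log_remainder; auto_derive; repeat split; nra. }
assert (If : is_RInt f a 1 (RInt f a 1)).
{ apply (RInt_correct (V := R_CompleteNormedModule)), (ex_RInt_continuous (V := R_CompleteNormedModule)).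
  rewrite Rmin_left, Rmax_right by lra; intros t Ht; apply continuous_log_integrand; lra. }
assert (Ig : is_RInt (fun t => f t - log_remainder (S N) t) a 1
               (log_boundary a + sum_n (fun k => log_series_term k a) N)).
{ replace (log_boundary a + sum_n (fun k => log_series_term k a) N)
    with (- (log_boundary 1 + sum_n (fun k => log_series_term k 1) N)
          - - (log_boundary a + sum_n (fun k => log_series_term k a) N)).
  - apply (is_RInt_derive (fun t => - (log_boundary t + sum_n (fun k => log_series_term k t) N)));
      rewrite Rmin_left, Rmax_right by lra; intros t Ht.
    + apply is_derive_log_partial_sum; lra.
    + apply (continuous_minus f); [apply continuous_log_integrand | apply Hcr]; lra.
  (* At t = 1 both arguments equal 1/2, so every term cancels; the boundary term vanishes there
     because ln 1 = 0. *)
  - assert (H1 : sum_n (fun k => log_series_term k 1) N = 0 :> R).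
    { clear; induction N as [|N IH]; [rewrite sum_O | rewrite sum_Sn, IH];
        unfold log_series_term; [| change plus with Rplus; cbv beta]; ring. }
    rewrite H1; unfold log_boundary at 1; rewrite ln_1; lra. }
assert (Ir : is_RInt (log_remainder (S N)) a 1
         (RInt f a 1 - (log_boundary a + sum_n (fun k => log_series_term k a) N))).
{ apply (is_RInt_ext (fun t => minus (f t) (f t - log_remainder (S N) t))).
  - intros t _; change (f t - (f t - log_remainder (S N) t) = log_remainder (S N) t); ring.
  - exact (is_RInt_minus _ _ _ _ _ _ If Ig). }
(* A primitive of the majorant, since y' = - x' = 1/(1+t)^2. *)
set (E := fun t => 2 * ((t / (1 + t)) ^ S N - (1 / (1 + t)) ^ S N) / INR (S N)).
assert (Ib : is_RInt (fun t => 2 * ((1 / (1 + t)) ^ N + (t / (1 + t)) ^ N) / (1 + t) ^ 2) a 1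
               (E 1 - E a)).
{ apply (is_RInt_derive E); rewrite Rmin_left, Rmax_right by lra; intros t Ht.
  - unfold E; set (c := INR (S N)) in *.
    auto_derive; [lra |].
    (* [auto_derive] leaves [INR (S N)] unfolded; it is folded back to [c]. *)
    change (match N with 0%nat => 1 | S _ => INR N + 1 end) with c.
    fold (t / (1 + t)) (1 / (1 + t)).
    set (X := (1 / (1 + t)) ^ N); set (Y := (t / (1 + t)) ^ N).
    field; lra.
  - apply @ex_derive_continuous; auto_derive; repeat split; try nra. }
assert (Hub : Rabs (RInt f a 1 - (log_boundary a + sum_n (fun k => log_series_term k a) N))
              <= E 1 - E a).
{ apply (norm_RInt_le _ _ _ _ _ _ (Rlt_le _ _ (proj2 Ha))) with (2 := Ir) (3 := Ib).
  intros t Ht; destruct (log_remainder_bounds N t ltac:(lra)).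
  change (Rabs (log_remainder (S N) t)
    <= 2 * ((1 / (1 + t)) ^ N + (t / (1 + t)) ^ N) / (1 + t) ^ 2).
  rewrite Rabs_pos_eq; lra. }
replace (RInt f a 1 - log_boundary a - sum_n (fun k => log_series_term k a) N)
  with (RInt f a 1 - (log_boundary a + sum_n (fun k => log_series_term k a) N)) by ring.
apply (Rle_trans _ _ _ Hub).
unfold E.
replace (1 / (1 + 1)) with (/ 2) by field.
assert (Hx : 0 <= 1 / (1 + a) <= 1).
{ split; [apply Rdiv_le_0_compat; lra |].
  apply Rmult_le_reg_r with (1 + a); [lra |]; unfold Rdiv; rewrite Rmult_assoc, Rinv_l; lra. }
assert (Hy : 0 <= a / (1 + a)) by (apply Rdiv_le_0_compat; lra).
assert (HxN : (1 / (1 + a)) ^ S N <= 1) by (generalize (pow_incr _ _ (S N) Hx); now rewrite pow1).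
assert (HyN := pow_le _ (S N) Hy).
replace (2 / INR (S N)) with (2 * 1 / INR (S N)) by (field; lra).
set (h := (/ 2) ^ S N); set (X := (1 / (1 + a)) ^ S N) in *; set (Y := (a / (1 + a)) ^ S N) in *.
replace (2 * (h - h) / INR (S N) - 2 * (Y - X) / INR (S N)) with (2 * (X - Y) / INR (S N))
  by (field; lra).
apply Rmult_le_compat_r; [apply Rlt_le, Rinv_0_lt_compat, HN | lra].
Qed.

(** As t tends to 0, x tends to 1, where the primitive equals 1/(k+1)^3, and y tends to 0+, where it
    vanishes in the limit. *)
Lemma filterlim_log_series_term_0 (k : nat) :
  filterlim (log_series_term k) (at_right 0) (locally (1 / INR (S k) ^ 3)).
Proof.
assert (Hx : filterlim (fun t => half_sqr_ln_primitive k (1 / (1 + t))) (at_right 0)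
               (locally (1 / INR (S k) ^ 3))).
{ replace (1 / INR (S k) ^ 3) with (half_sqr_ln_primitive k (1 / (1 + 0))).
  - apply (continuous_filterlim_at_right (fun t => half_sqr_ln_primitive k (1 / (1 + t)))).
    apply (continuous_comp (fun t => 1 / (1 + t))).
    + apply @ex_derive_continuous; auto_derive; lra.
    + apply (ex_derive_continuous (half_sqr_ln_primitive k)); eexists.
      apply is_derive_half_sqr_ln_primitive; lra.
  - assert (0 < INR (S k)) by (apply lt_0_INR; lia).
    unfold half_sqr_ln_primitive; replace (1 / (1 + 0)) with 1 by field.
    rewrite ln_1, pow1; field; lra. }
assert (Hy := filterlim_comp _ _ _ _ _ _ _ _ filterlim_ratio_0
                (filterlim_half_sqr_ln_primitive_0 k)).
apply (filterlim_comp _ _ _ _ Ropp _ _ (locally (- 0))) in Hy; [| apply (filterlim_opp 0)].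
replace (1 / INR (S k) ^ 3) with (1 / INR (S k) ^ 3 + - 0) by ring.
exact (filterlim_comp_2 _ _ Rplus Hx Hy (filterlim_plus _ _)).
Qed.

Lemma filterlim_log_integral :
  filterlim (fun a => RInt (fun t => ln (1 + t) * ln (1 + 1 / t) / t) a 1)
    (at_right 0) (locally zeta3).
Proof.
assert (H : filterlim (fun a => RInt (fun t => ln (1 + t) * ln (1 + 1 / t) / t) a 1
                                - log_boundary a) (at_right 0) (locally zeta3)).
{ apply (filterlim_series_remainder _ log_series_term (fun k => 1 / INR (S k) ^ 3) _ 2).
  - exact filterlim_log_series_term_0.
  - exact is_series_zeta3.
  - exact log_integral_sub_partial_sum. }
rewrite <- (Rplus_0_r zeta3).
apply (filterlim_ext (fun a => (RInt (fun t => ln (1 + t) * ln (1 + 1 / t) / t) a 1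
                               - log_boundary a) + log_boundary a)); [intros a; ring |].
exact (filterlim_comp_2 _ _ Rplus H filterlim_log_boundary_0 (filterlim_plus _ _)).
Qed.

(** * Values of the improper integrals *)

Lemma is_RInt_gen_log :
  is_RInt_gen (fun t => ln (1 + t) * ln (1 + 1 / t) / t) (at_right 0) (at_point 1) zeta3.
Proof.
apply (is_RInt_gen_at_right_0 _ _ _) with (2 := filterlim_log_integral).
intros a Ha.
apply (RInt_correct (V := R_CompleteNormedModule)), (ex_RInt_continuous (V := R_CompleteNormedModule)).
rewrite Rmin_left, Rmax_right by lra; intros t Ht; apply continuous_log_integrand; lra.
Qed.

Lemma is_RInt_gen_atan_pow_div (m : nat) (l : R) :
  filterlim (fun a => RInt (fun u => u ^ m / sin u) a (PI / 2)) (at_right 0) (locally l) ->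
  is_RInt_gen (fun t => atan t ^ m / t) (at_right 0) (at_point 1) (/ 2 ^ m * l).
Proof.
intros Hl; apply (is_RInt_gen_at_right_0 _ _ _ (is_RInt_atan_pow_div m)).
apply (filterlim_comp _ _ _ (fun a => RInt (fun u => u ^ m / sin u) (2 * atan a) (PI / 2))
         (scal (/ 2 ^ m)) _ (locally l)); [| apply (filterlim_scal_r (/ 2 ^ m) l)].
exact (filterlim_comp _ _ _ _ _ _ _ _ filterlim_2_atan Hl).
Qed.

Lemma is_RInt_gen_atan_div :
  is_RInt_gen (fun t => atan t / t) (at_right 0) (at_point 1) Catalan.
Proof.
replace Catalan with (/ 2 ^ 1 * (2 * Catalan)) by field.
apply (is_RInt_gen_ext (fun t => atan t ^ 1 / t)).
- apply filter_forall; intros ab t _; now rewrite pow_1.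
- apply is_RInt_gen_atan_pow_div.
  apply (filterlim_ext (fun a => RInt (fun u => u / sin u) a (PI / 2)));
    [| exact filterlim_RInt_id_div_sin].
  intros a; apply RInt_ext; intros u _; now rewrite pow_1.
Qed.

Lemma is_RInt_gen_atan_sqr_div :
  is_RInt_gen (fun t => atan t ^ 2 / t) (at_right 0) (at_point 1)
    (PI / 2 * Catalan - 7 / 8 * zeta3).
Proof.
replace (PI / 2 * Catalan - 7 / 8 * zeta3)
  with (/ 2 ^ 2 * (2 * PI * Catalan - 7 / 2 * zeta3)) by field.
apply is_RInt_gen_atan_pow_div, filterlim_RInt_sqr_div_sin.
Qed.

(** For t > 0, atan(1/t) = PI/2 - atan t, so the integral is PI/2 times Catalan's constant minus the
    integral of (atan t)^2 / t. *)
Lemma is_RInt_gen_atan_atan_inv_div :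
  is_RInt_gen (fun t => atan t * atan (1 / t) / t) (at_right 0) (at_point 1) (7 / 8 * zeta3).
Proof.
replace (7 / 8 * zeta3) with (PI / 2 * Catalan - (PI / 2 * Catalan - 7 / 8 * zeta3)) by ring.
apply (is_RInt_gen_ext (fun t => minus (scal (PI / 2) (atan t / t)) (atan t ^ 2 / t))).
- apply Filter_prod with (Q := fun a => 0 < a) (R := fun b => b = 1).
  + exists (mkposreal 1 Rlt_0_1); intros y _ Hy; exact Hy.
  + reflexivity.
  + intros a b Ha -> t Ht; simpl in Ht.
    assert (Ht0 : 0 < t).
    { apply Rle_lt_trans with (2 := proj1 Ht), Rmin_glb; lra. }
    change (PI / 2 * (atan t / t) - atan t ^ 2 / t = atan t * atan (1 / t) / t).
    (* The fifth quotient is the [1 / t] inside [atan], brought to the form [/ t] that [atan_inv]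
       expects. *)
    unfold Rdiv at 5; rewrite Rmult_1_l, atan_inv by easy; field; lra.
- apply (is_RInt_gen_minus (fun t => scal (PI / 2) (atan t / t)));
    [| exact is_RInt_gen_atan_sqr_div].
  apply (is_RInt_gen_scal (fun t => atan t / t)), is_RInt_gen_atan_div.
Qed.

Theorem corollary8 :
  (ex_RInt01 (fun t => atan t * atan (1 / t) / t) /\
   zeta3 = 8 / 7 * RInt01 (fun t => atan t * atan (1 / t) / t)) /\
  (ex_RInt01 (fun t => ln (1 + t) * ln (1 + 1 / t) / t) /\
   zeta3 = RInt01 (fun t => ln (1 + t) * ln (1 + 1 / t) / t)) /\
  (zeta3 = 8 / 7 * RInt01 (fun t => atan t * atan (1 / t) / t) <->
   RInt01 (fun t => atan t ^ 2 / t) = PI / 2 * Catalan - 7 / 8 * zeta3) /\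
  (ex_RInt01 (fun t => atan t ^ 2 / t) /\
   RInt01 (fun t => atan t ^ 2 / t) = PI / 2 * Catalan - 7 / 8 * zeta3).
Proof.
unfold RInt01, ex_RInt01.
rewrite (is_RInt_gen_unique _ _ is_RInt_gen_atan_atan_inv_div).
rewrite (is_RInt_gen_unique _ _ is_RInt_gen_log).
rewrite (is_RInt_gen_unique _ _ is_RInt_gen_atan_sqr_div).
assert (Hz : zeta3 = 8 / 7 * (7 / 8 * zeta3)) by field.
split; [| split; [| split]].
- split; [eexists; exact is_RInt_gen_atan_atan_inv_div | exact Hz].
- split; [eexists; exact is_RInt_gen_log | reflexivity].
(* With the integrals replaced by their values, both sides of the equivalence are proved
   identities. *)
- split; intros _; [reflexivity | exact Hz].
- split; [eexists; exact is_RInt_gen_atan_sqr_div | reflexivity].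
Qed.
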